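(* Let $\nu$ be a symmetric L\'evy measure on $\mathbb{R}^n$ and let $\Omega\subseteq\mathbb{R}^n$ be nonempty, open and bounded. Let $f\in L^2(\Omega)$ and $g:\Omega^c\to\mathbb{R}$ satisfy $f\ge0$ a.e. in $\Omega$ and $g\ge0$ a.e. in $\Omega^c$, and let $u$ be a weak solution of the problem $Lu=f$ in $\Omega$, $u=g$ in $\Omega^c$. Then $u\ge0$ a.e.
   Context: All functions are real-valued; $\Omega^c=\mathbb{R}^n\setminus\Omega$; a.e. refers to Lebesgue measure. A symmetric L\'evy measure is a nonnegative Borel measure $\nu$ on $\mathbb{R}^n$ with $\nu(\{0\})=0$, $\nu(-A)=\nu(A)$ for every Borel $A$, and $\int_{\mathbb{R}^n}(1\wedge|y|^2)\,d\nu(y)<\infty$. For $x\in\mathbb{R}^n$, $\nu_x(A)=\nu(A-x)$. $V_\nu^\Omega(\mathbb{R}^n)$ is the space of Borel measurable $u$ on $\mathbb{R}^n$ (identified if equal a.e.) with $\|u\|_{L^2(\Omega)}^2+\frac12\int_\Omega\int_{\mathbb{R}^n}(u(x)-u(y))^2\,d\nu_y(x)\,dy<\infty$, and $H_\nu^\Omega(\mathbb{R}^n)=\{u\in V_\nu^\Omega(\mathbb{R}^n):u=0\text{ a.e. in }\Omega^c\}$. A weak solution of the problem $Lu=f$ in $\Omega$, $u=g$ in $\Omega^c$ (where $L$ is the operator associated with $\nu$, $Lu(x)=\lim_{\varepsilon\to0^+}\int_{\mathbb{R}^n\setminus B(0,\varepsilon)}(u(x)-u(x+y))\,d\nu(y)$)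 is a function $u\in V_\nu^\Omega(\mathbb{R}^n)$ such that $u=g$ a.e. in $\Omega^c$ and $$\frac12\int_{\mathbb{R}^n}\int_{\mathbb{R}^n}(u(x)-u(y))(\phi(x)-\phi(y))\,d\nu_y(x)\,dy=\int_\Omega f\phi\,dx\qquad\text{for every }\phi\in H_\nu^\Omega(\mathbb{R}^n).$$
   Formalization: The Lévy measure ν is additionally assumed to be nonzero; for ν = 0 the claim is false, since with f = 0 and g = 0 the function equal to −1 on Ω and 0 outside Ω is a weak solution. *)

(* Defs.v *)
From HB Require Import structures.
From mathcomp Require Import all_boot all_order all_algebra.
From mathcomp Require Import all_classical all_reals all_analysis measurable_realfun.

Set Implicit Arguments.
Unset Strict Implicit.
Unset Printing Implicit Defensive.

Import Order.TTheory GRing.Theory Num.Theory.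
Import numFieldNormedType.Exports.

Local Open Scope classical_set_scope.
Local Open Scope ring_scope.

(* R^n is 'rV[R]_n, with the Borel sigma-algebra of its topology. *)
HB.instance Definition _ (R : realType) (m n : nat) :=
  @isMeasurable.Build (sigma_display (@open 'M[R]_(m, n))) 'M[R]_(m, n)
    <<s @open 'M[R]_(m, n) >> (@sigma_algebra0 _ setT open)
    (@sigma_algebraC _ open) (@sigma_algebra_bigcup _ setT open).

Section matrix_measurability.
Context {R : realType}.

Lemma continuous_measurable_mx (m n p q : nat) (f : 'M[R]_(m, n) -> 'M[R]_(p, q)) :
  continuous f -> measurable_fun setT f.
Proof.
move=> /continuousP cf; apply: (@measurability _ _ _ 'M[R]_(p, q) setT f (@open 'M[R]_(p,q))) => //.
move=> _ [U oU <-]; rewrite setTI.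
by apply: sub_sigma_algebra; exact: cf.
Qed.

Lemma measurable_fun_mx (d : measure_display) (T : measurableType d) (m n : nat)
    (f : T -> 'M[R]_(m, n)) :
  (forall i j, measurable_fun setT (fun t => f t i j)) -> measurable_fun setT f.
Proof.
move=> mf; apply: (@measurability _ _ _ 'M[R]_(m, n) setT f (@open 'M[R]_(m, n))) => //.
move=> _ [U oU <-]; rewrite setTI.
pose B (qk : 'M[rat]_(m, n) * nat) : set 'M[R]_(m, n) :=
  [set x | forall i j, ball (ratr (qk.1 i j) : R) qk.2.+1%:R^-1 (x i j)].
pose F qk := if `[< B qk `<=` U >] then f @^-1` B qk else set0.
have -> : f @^-1` U = \bigcup_qk F qk.
  apply/seteqP; split=> [t Uft|t [qk _]]; last first.
    by rewrite /F; case: asboolP => // BU; exact: BU.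
  have /nbhs_ballP[e /= e0 eU] : nbhs (f t) U by exact: open_nbhs_nbhs.
  have [k ke] : exists k : nat, k.+1%:R^-1 < e / 2 :> R.
    have e20 : 0 < e / 2 by rewrite divr_gt0.
    have [k _ /(_ k (leqnn k))] := near_infty_natSinv_lt (PosNum e20).
    by exists k.
  pose d0 : R := k.+1%:R^-1.
  have d00 : 0 < d0 by rewrite invr_gt0 ltr0n.
  have q_ij i j : {q : rat | ball (ratr q : R) d0 (f t i j)}.
    apply: cid.
    have [q] : exists q : rat, ratr q \in `](f t i j - d0)%R, (f t i j + d0)%R[.
      have /rat_in_itvoo[q ?] : f t i j - d0 < f t i j + d0.
        by rewrite ltrBlDr -addrA ltrDl addr_gt0.
      by exists q.
    rewrite in_itv /= => /andP[q1 q2]; exists q.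
    by rewrite /ball /= ltr_distl ltrBlDr q2 /= -ltrBlDr q1.
  pose q : 'M[rat]_(m, n) := \matrix_(i, j) sval (q_ij i j).
  exists (q, k) => //; rewrite /F.
  have Bft : B (q, k) (f t) by move=> i j; rewrite mxE; exact: (svalP (q_ij i j)).
  case: asboolP => // -[] x Bx; apply: eU; split => // i j.
  have := Bft i j; have := Bx i j; rewrite /ball /= => x1 x2.
  rewrite -[ltLHS]/(`|f t i j - x i j|).
  rewrite -(subrKA (ratr (q i j))) (le_lt_trans (ler_normD _ _))//.
  rewrite (splitr e) ltrD//.
    by rewrite distrC (lt_trans x2).
  by rewrite (lt_trans x1).
apply: countable_bigcupT_measurable => [|qk]; first exact: countableP.
rewrite /F; case: asboolP => // _.
rewrite [X in measurable X](_ : _ = \bigcap_(ij in [set: 'I_m * 'I_n])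
    ((fun t => f t ij.1 ij.2) @^-1` ball (ratr (qk.1 ij.1 ij.2) : R) qk.2.+1%:R^-1)).
  apply: fin_bigcap_measurable => [|ij _]; first exact: finite_finset.
  rewrite -[X in measurable X]setTI; apply: mf => //.
  exact: measurable_ball.
by apply/seteqP; split=> [t Bt [i j] _|t Bt i j]; [exact: Bt|exact: (Bt (i, j))].
Qed.
End matrix_measurability.

Section lebesgue_measure_rV.
Context {R : realType}.

(* Prepends the last component: (x, t) |-> (t, x_1, ..., x_n). *)
Definition row_cons (n : nat) (p : 'rV[R]_n * measurableTypeR R) : 'rV[R]_n.+1 :=
  row_mx (const_mx p.2 : 'rV[R]_1) p.1.

Lemma measurable_row_cons (n : nat) : measurable_fun setT (@row_cons n).
Proof.
apply: measurable_fun_mx => i j.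
case: (split_ordP (j : 'I_(1 + n))) => k ->.
  rewrite (_ : (fun p => _) = snd); first exact: measurable_snd.
  by apply/funext => p; apply: etrans (row_mxEl _ _ i k) _; rewrite mxE.
rewrite (_ : (fun p => _) = (fun x : 'rV[R]_n => x i k) \o fst); last first.
  by apply/funext => p; exact: row_mxEr.
apply: measurableT_comp; last exact: measurable_fst.
apply: (measurability _ (RGenOpens.measurableE R)).
move=> _ [_ [a [b ->] <-]]; rewrite setTI.
apply: sub_sigma_algebra.
have /continuousP : continuous (fun x : 'rV[R]_n => x i k) by exact: coord_continuous.
by apply; exact: interval_open.
Qed.

Definition measure_pushforward d1 d2 (T1 : measurableType d1) (T2 : measurableType d2)
    (m : {measure set T1 -> \bar R}) (f : T1 -> T2) (mf : measurable_fun setT f) :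
  {measure set T2 -> \bar R} :=
  measure_function_pushforward__canonical__measure_function_Measure m mf.

(* Lebesgue measure on R^n, as the n-fold product of the one-dimensional one. *)
Fixpoint lebesgue_rV (n : nat) : {measure set 'rV[R]_n -> \bar R} :=
  match n with
  | 0 => \d_ (0 : 'rV[R]_0)
  | k.+1 => measure_pushforward
      (product_measure1 (lebesgue_rV k) (@lebesgue_measure R)) (@measurable_row_cons k)
  end.

End lebesgue_measure_rV.

Section levy.
Context {R : realType} {n : nat}.
Implicit Types (nu : {measure set 'rV[R]_n -> \bar R}) (Omega : set 'rV[R]_n).
Implicit Types (f g u phi : 'rV[R]_n -> R).

(* The norm `|x| of 'rV[R]_n is the sup norm. *)
Definition euclidean_norm (x : 'rV[R]_n) : R := Num.sqrt (\sum_i x 0 i ^+ 2).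

Definition symmetric_levy_measure nu : Prop :=
  [/\ nu [set 0] = 0%E,
      (forall A : set 'rV[R]_n, measurable A -> nu [set - y | y in A] = nu A) &
      (\int[nu]_y (Num.min 1 (euclidean_norm y ^+ 2))%:E < +oo)%E].

Lemma measurable_translation (x : 'rV[R]_n) :
  measurable_fun setT (fun h : 'rV[R]_n => h + x).
Proof.
apply: continuous_measurable_mx => h.
by apply: (@cvgD _ _ _ (nbhs h)); [exact: cvg_id|exact: cvg_cst].
Qed.

(* nu_x (A) = nu (A - x), and A - x is the preimage of A under h |-> h + x. *)
Definition levy_at nu (x : 'rV[R]_n) : {measure set 'rV[R]_n -> \bar R} :=
  measure_pushforward nu (measurable_translation x).

Definition in_L2 Omega f : Prop :=
  measurable_fun Omega f /\
  (\int[lebesgue_rV n]_(x in Omega) (f x ^+ 2)%:E < +oo)%E.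

Definition in_V nu Omega u : Prop :=
  measurable_fun setT u /\
  (\int[lebesgue_rV n]_(x in Omega) (u x ^+ 2)%:E +
   (2^-1)%:E * \int[lebesgue_rV n]_(y in Omega)
                 \int[levy_at nu y]_x ((u x - u y) ^+ 2)%:E < +oo)%E.

Definition in_H nu Omega u : Prop :=
  in_V nu Omega u /\ {ae lebesgue_rV n, forall x, (~` Omega) x -> u x = 0}.

Definition weak_solution nu Omega f g u : Prop :=
  [/\ in_V nu Omega u,
      {ae lebesgue_rV n, forall x, (~` Omega) x -> u x = g x} &
      forall phi, in_H nu Omega phi ->
        ((2^-1)%:E * \int[lebesgue_rV n]_y
                       \int[levy_at nu y]_x ((u x - u y) * (phi x - phi y))%:E =
         \int[lebesgue_rV n]_(x in Omega) (f x * phi x)%:E)%E].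

End levy.

(* Main.v *)
From HB Require Import structures.
Require Import Defs.
From mathcomp Require Import all_boot all_order all_algebra.
From mathcomp Require Import all_classical all_reals all_analysis.
From mathcomp Require Import measurable_realfun lra.
Import Order.TTheory GRing.Theory Num.Theory.
Import numFieldNormedType.Exports.
Local Open Scope classical_set_scope.
Local Open Scope ring_scope.

(** The proof tests the equation against the negative part [u^\-] of the weak
    solution.  It vanishes almost everywhere outside [Omega] because [g >= 0],
    and its energy is controlled by that of [u], so it is an admissible test
    function ([funrneg_in_V]).  The right-hand side, the integral of
    [f * u^\-], is nonnegative.  On the left-hand side the pointwise inequality
    (a - b) (a^- - b^-) <= - (a^- - b^-)^2 ([neg_part_energy]) bounds the pairing
    of [u] with [u^\-] by minus half the energy of [u^\-].  Hence this energy,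
    the double integral of (u^-(x) - u^-(y))^2, is zero
    ([weak_solution_neg_part_energy_eq0]).

    In the coordinates (y, h) with x = h + y, Tonelli's theorem, which applies
    because a Levy measure is sigma-finite ([sigma_finite_levy]), turns zero
    energy into: for almost every jump [h] of the Levy measure, [u^\-] is
    almost everywhere invariant under the translation by [h]
    ([dirichlet_eq0_ae_translate]).  The Levy measure is nonzero and does not
    charge the origin, so one such [h] is nonzero.  A function that is periodic
    in a nonzero direction and vanishes outside a bounded set is zero
    ([ae_periodic_bounded_support_eq0]); this last step uses that translations
    preserve Lebesgue null sets ([lebesgue_rV_translate]). *)

(** * Tonelli's theorem and vanishing integrals *)

(** Tonelli's theorem is stated for measures carrying sigma-finiteness as a
    structure.  The Levy measure and [lebesgue_rV] carry it only as a proved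
    property, so they are first replaced by an equal bundled measure. *)
Lemma sigma_finite_measureE {d : measure_display} {T : measurableType d}
    {R : realType} (mu : {measure set T -> \bar R}) :
  sigma_finite setT mu ->
  {mu' : {sigma_finite_measure set T -> \bar R} | mu' = mu :> {measure set T -> \bar R}}.
Proof.
move=> s.
pose H1 := isSFinite.Build _ _ _ _ (sfinite_measure_sigma_finite s).
pose H2 := isSigmaFinite.Build _ _ _ _ s.
pose mu' := HB.pack_for {sigma_finite_measure set T -> \bar R} (Measure.sort mu) H1 H2.
by exists mu'; exact: eq_measure.
Qed.

Lemma fubini_tonelli_sigma_finite {d1 d2 : measure_display}
    {T1 : measurableType d1} {T2 : measurableType d2} {R : realType}
    (m1 : {measure set T1 -> \bar R}) (m2 : {measure set T2 -> \bar R})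
    (f : T1 * T2 -> \bar R) :
  sigma_finite setT m1 -> sigma_finite setT m2 ->
  measurable_fun setT f -> (forall z, 0 <= f z)%E ->
  (\int[m1]_x \int[m2]_y f (x, y) = \int[m2]_y \int[m1]_x f (x, y))%E.
Proof.
move=> s1 s2 mf f0.
have [m1' m1E] := sigma_finite_measureE m1 s1.
have [m2' m2E] := sigma_finite_measureE m2 s2.
by rewrite -m1E -m2E; exact: fubini_tonelli.
Qed.

Lemma measurable_fun_integral_section {d1 d2 : measure_display}
    {T1 : measurableType d1} {T2 : measurableType d2} {R : realType}
    (m2 : {measure set T2 -> \bar R}) (f : T1 * T2 -> \bar R) :
  sigma_finite setT m2 -> measurable_fun setT f -> (forall z, 0 <= f z)%E ->
  measurable_fun setT (fun x => \int[m2]_y f (x, y))%E.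
Proof.
move=> s2 mf f0.
have [m2' m2E] := sigma_finite_measureE m2 s2.
by rewrite -m2E; exact: measurable_fun_fubini_tonelli_F.
Qed.

Lemma ge0_integral_eq0_ae {d : measure_display} {T : measurableType d}
    {R : realType} (mu : {measure set T -> \bar R}) (f : T -> \bar R) :
  measurable_fun setT f -> (forall x, 0 <= f x)%E ->
  (\int[mu]_x f x = 0)%E -> {ae mu, forall x, f x = 0%E}.
Proof.
move=> mf f0 if0.
have [/(_ _)] := ae_eq_integral_abs mu measurableT mf.
have -> : (\int[mu]_x `|f x| = 0)%E.
  by rewrite -[RHS]if0; apply: eq_integral => x _; rewrite gee0_abs.
by move=> /(_ erefl) + _; apply: filterS => x /(_ I).
Qed.

(** * Coordinates and measurability in R^n *)
Lemma measurable_coord {R : realType} {n : nat} (i : 'I_n) :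
  measurable_fun setT (fun x : 'rV[R]_n => x 0 i).
Proof.
apply: (measurability _ (RGenOpens.measurableE R)).
move=> _ [_ [a [b ->] <-]]; rewrite setTI; apply: sub_sigma_algebra.
have /continuousP : continuous (fun x : 'rV[R]_n => x 0 i) by exact: coord_continuous.
by apply; exact: interval_open.
Qed.

Lemma measurable_open_rV {R : realType} {n : nat} (A : set 'rV[R]_n) :
  open A -> measurable A.
Proof. by move=> oA; exact: sub_sigma_algebra. Qed.

Lemma measurable_zero_rV {R : realType} {n : nat} :
  measurable [set (0 : 'rV[R]_n)].
Proof.
rewrite (_ : [set _] = \bigcap_(i in [set: 'I_n])
    ((fun x : 'rV[R]_n => x 0 i) @^-1` [set 0])).
  apply: fin_bigcap_measurable => [|i _]; first exact: finite_finset.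
  by rewrite -[X in measurable X]setTI; apply: measurable_coord.
apply/seteqP; split=> [x -> i _|x x0]; first by rewrite /= mxE.
by apply/rowP => i; rewrite mxE; exact: x0.
Qed.

Lemma measurable_fun_addrV {d : measure_display} {T : measurableType d}
    {R : realType} {n : nat} (f g : T -> 'rV[R]_n) :
  measurable_fun setT f -> measurable_fun setT g ->
  measurable_fun setT (fun t => f t + g t).
Proof.
move=> mf mg; apply: measurable_fun_mx => i j; rewrite ord1.
under eq_fun do rewrite mxE.
apply: measurable_funD.
  exact: (measurableT_comp (measurable_coord j) mf).
exact: (measurableT_comp (measurable_coord j) mg).
Qed.

Lemma row_neq0_coord {R : realType} {n : nat} (x : 'rV[R]_n) :
  x != 0 -> exists i, x 0 i != 0.
Proof.
move=> x0; apply/existsP; apply: contraR x0 => /existsPn x0.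
by apply/eqP/rowP => i; rewrite mxE; apply/eqP/negPn/x0.
Qed.

Lemma norm_coord_le {R : realType} {n : nat} (x : 'rV[R]_n) (i : 'I_n) :
  `|x 0 i| <= `|x|.
Proof.
rewrite [leRHS]mx_normrE.
exact: (le_bigmax _ (fun ij => `|x ij.1 ij.2|) (0, i)).
Qed.

(** * Lebesgue measure on R^n: translation invariance, sigma-finiteness *)
Lemma lebesgue_measure_shift {R : realType} (c : R) (A : set (measurableTypeR R)) :
  measurable A -> lebesgue_measure ((fun t : measurableTypeR R => t + c) @^-1` A) =
  lebesgue_measure A.
Proof.
move=> mA.
have mc : measurable_fun setT (fun t : measurableTypeR R => t + c : measurableTypeR R).
  exact: measurable_funD.
rewrite -[LHS]/(measure_pushforward (@lebesgue_measure R) mc A).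
apply/esym/lebesgue_measure_unique => // _ [[a b] _ <-] /=.
rewrite /pushforward (_ : _ @^-1` _ = `]a - c, b - c]%classic); last first.
  by apply/seteqP; split => t /=; rewrite !in_itv/= ltrBlDr lerBrDr.
rewrite !lebesgue_measure_itv/= !lte_fin ltrD2r; case: ifP => // _.
by rewrite -!EFinB opprB addrA subrK.
Qed.

Lemma lebesgue_rVS {R : realType} (n : nat) (A : set 'rV[R]_n.+1) :
  lebesgue_rV n.+1 A =
  (\int[lebesgue_rV n]_x
     lebesgue_measure [set t : measurableTypeR R | A (row_cons (x, t))])%E.
Proof.
rewrite /= /pushforward /product_measure1; apply: eq_integral => x _ /=.
by congr lebesgue_measure; apply/seteqP; split => t /=; rewrite /xsection/= inE.
Qed.

Lemma measurable_lebesgue_section {R : realType} (n : nat) (A : set 'rV[R]_n.+1) :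
  measurable A -> measurable_fun setT (fun x : 'rV[R]_n =>
     lebesgue_measure [set t : measurableTypeR R | A (row_cons (x, t))]).
Proof.
move=> mA.
have mA' : measurable (@row_cons R n @^-1` A).
  by rewrite -[X in measurable X]setTI; apply: measurable_row_cons.
have := measurable_fun_xsection (@lebesgue_measure R) mA'.
congr (measurable_fun _ _); apply/funext => x /=.
by congr lebesgue_measure; apply/seteqP; split => t /=; rewrite /xsection/= inE.
Qed.

Lemma row_cons_l {R : realType} {n : nat} (p : 'rV[R]_n * measurableTypeR R) (j : 'I_1) :
  row_cons p 0 (lshift n j : 'I_(1 + n)) = p.2.
Proof. by apply: etrans (row_mxEl _ _ 0 j) _; rewrite mxE. Qed.

Lemma row_cons_r {R : realType} {n : nat} (p : 'rV[R]_n * measurableTypeR R) (k : 'I_n) :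
  row_cons p 0 (rshift 1 k : 'I_(1 + n)) = p.1 0 k.
Proof. exact: (row_mxEr _ _ 0 k). Qed.

Lemma row_cons_add {R : realType} (n : nat) (x : 'rV[R]_n) t (h : 'rV[R]_n.+1) :
  row_cons (x, t) + h =
  row_cons (x + rsubmx (h : 'rV_(1 + n)),
            (t : R) + (h : 'rV_(1 + n)) 0 (lshift n 0)).
Proof.
apply/rowP => j; rewrite mxE.
case: (split_ordP (j : 'I_(1 + n))) => k ->.
  by rewrite !row_cons_l (ord1 k).
by rewrite !row_cons_r !mxE.
Qed.

(** By induction on the dimension.  Slicing along the prepended coordinate, a
    translation acts on each slice by a shift of the line, which preserves
    the inner measure, and on the base by a translation of R^n, which is
    handled by a change of variable and the induction hypothesis. *)
Lemma lebesgue_rV_translate {R : realType} {n : nat} (h : 'rV[R]_n) (A : set 'rV[R]_n) :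
  measurable A -> lebesgue_rV n ((fun x => x + h) @^-1` A) = lebesgue_rV n A.
Proof.
elim: n h A => [|n IH] h A mA.
  by congr (lebesgue_rV 0 _); apply/seteqP; split => x /=;
    rewrite (thinmx0 (x + h)) (thinmx0 x).
rewrite !lebesgue_rVS.
set h' := rsubmx (h : 'rV_(1 + n)).
set c := (h : 'rV_(1 + n)) 0 (lshift n 0).
transitivity (\int[lebesgue_rV n]_x
   lebesgue_measure [set t : measurableTypeR R | A (row_cons ((x + h')%R, t))])%E.
  apply: eq_integral => x _.
  rewrite -[RHS](lebesgue_measure_shift c); last first.
    rewrite -[X in measurable X]/((fun t => row_cons ((x + h')%R, t)) @^-1` A).
    rewrite -[X in measurable X]setTI.
    apply: (measurableT_comp (@measurable_row_cons R n)) => //.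
  by congr lebesgue_measure; apply/seteqP; split => t /=; rewrite row_cons_add.
have eq_pf : forall B, measurable B ->
    pushforward (lebesgue_rV n) (fun x : 'rV[R]_n => x + h') B = lebesgue_rV n B.
  by move=> B mB; rewrite /pushforward IH.
have := @ge0_integral_pushforward _ _ _ _ R _ (measurable_translation h')
  (lebesgue_rV n) setT _ measurableT (measurable_lebesgue_section _ _ mA)
  (fun _ _ => measure_ge0 _ _).
rewrite preimage_setT /= => <-.
apply: (eq_measure_integral (lebesgue_rV n)) => [|? B mB _].
  exact: measurable_translation.
exact: eq_pf.
Qed.

(** The cubes [[-k, k]^n] exhaust R^n and have finite measure. *)
Definition boxrV {R : realType} (n : nat) (k : R) : set 'rV[R]_n :=
  [set x | forall i, `[- k, k]%classic (x 0 i)].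

Lemma measurable_boxrV {R : realType} n (k : R) : measurable (boxrV n k).
Proof.
rewrite (_ : boxrV n k = \bigcap_(i in [set: 'I_n])
    ((fun x : 'rV[R]_n => x 0 i) @^-1` `[- k, k]%classic)).
  apply: fin_bigcap_measurable => [|i _]; first exact: finite_finset.
  by rewrite -[X in measurable X]setTI; apply: measurable_coord.
by apply/seteqP; split=> [x bx i _|x bx i]; [exact: bx|exact: (bx i)].
Qed.

Lemma lebesgue_boxrV_lty {R : realType} n (k : R) : (lebesgue_rV n (boxrV n k) < +oo)%E.
Proof.
elim: n => [|n IH].
  by rewrite /= diracE; case: (_ \in _); rewrite ltry.
rewrite -[ltLHS]/(product_measure1 (lebesgue_rV n) (@lebesgue_measure R)
  (@row_cons R n @^-1` boxrV n.+1 k)).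
rewrite (_ : _ @^-1` _ = boxrV n k `*` `[- k, k]%classic).
  rewrite product_measure1E//=; last exact: measurable_boxrV.
  rewrite lte_mul_pinfty// ?ge0_fin_numE//.
  rewrite lebesgue_measure_itv/=; case: ifP => _; rewrite ?ltry//.
apply/seteqP; split=> [[x t] /= bx|[x t] /= [bx kt] i].
  split=> [i|].
    by have := bx (rshift 1 i : 'I_(1 + n)); rewrite row_cons_r.
  by have := bx (lshift n 0 : 'I_(1 + n)); rewrite row_cons_l.
case: (split_ordP (i : 'I_(1 + n))) => j ->.
  by rewrite row_cons_l.
by rewrite row_cons_r; exact: bx.
Qed.

Lemma sigma_finite_lebesgue_rV {R : realType} n : sigma_finite setT (@lebesgue_rV R n).
Proof.
exists (fun k => boxrV n k%:R) => [|k]; last first.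
  by split; [exact: measurable_boxrV|exact: lebesgue_boxrV_lty].
apply/esym; rewrite -subTset => x _.
exists (Num.bound `|x|) => // i; rewrite /= in_itv/= -ler_norml.
by rewrite (le_trans (norm_coord_le _ _))// ltW// archi_boundP.
Qed.

(** Translation invariance enters the argument only through this
    consequence: a property that holds almost everywhere can be used at all
    points [x + h *+ k], [k] natural, for almost every [x]. *)
Lemma ae_translate {R : realType} {n : nat} (h : 'rV[R]_n) (P : 'rV[R]_n -> Prop) :
  {ae lebesgue_rV n, forall x, P x} -> {ae lebesgue_rV n, forall x, P (x + h)}.
Proof.
move=> [N [mN N0 PN]]; exists ((fun x => x + h) @^-1` N); split.
- by rewrite -[X in measurable X]setTI; apply: measurable_translation.
- by rewrite lebesgue_rV_translate.
- by move=> x /= nPx; exact: PN.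
Qed.

(** * Integration against a Levy measure *)

(** With [m y] the minimum of 1 and [|y|^2], Markov's inequality bounds the
    measure of each set [m y >= 1 / (k + 1)] by [(k + 1)] times the finite
    integral of [m].  As [m] vanishes only at the origin, these sets together
    with the null set [{0}] cover R^n. *)
Lemma sigma_finite_levy {R : realType} {n : nat}
    (nu : {measure set 'rV[R]_n -> \bar R}) :
  symmetric_levy_measure nu -> sigma_finite setT nu.
Proof.
move=> [nu0 _ nu_fin].
pose m (y : 'rV[R]_n) := Num.min 1 (euclidean_norm y ^+ 2).
have sum0 (y : 'rV[R]_n) : 0 <= \sum_i y 0 i ^+ 2.
  by apply: sumr_ge0 => i _; exact: sqr_ge0.
have mE y : m y = Num.min 1 (\sum_i y 0 i ^+ 2).
  by rewrite /m /euclidean_norm sqr_sqrtr.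
have m0 y : 0 <= m y by rewrite mE le_min ler01 sum0.
have mm : measurable_fun setT (EFin \o m).
  apply/measurable_EFinP; rewrite (funext mE).
  apply: measurable_minr => //; apply: measurable_sum => i.
  by apply: measurable_funX; exact: measurable_coord.
pose F k : set 'rV[R]_n :=
  [set 0] `|` (setT `&` [set y | (k.+1%:R^-1%:E <= `|(EFin \o m) y|)%E]).
exists F => [|k].
  apply/esym; rewrite -subTset => y _.
  have [->|y0] := eqVneq y 0; first by exists 0%N => //; left.
  have [i yi] := row_neq0_coord _ y0.
  have my : 0 < m y.
    rewrite mE lt_min ltr01 /= (bigD1 i)//= ltr_pwDl//.
      by rewrite exprn_even_gt0.
    by apply: sumr_ge0 => j _; exact: sqr_ge0.
  have [k _ /(_ k (leqnn k)) mk] := near_infty_natSinv_lt (PosNum my).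
  by exists k => //; right; split => //=; rewrite lee_fin ger0_norm// ltW.
have mFk : measurable (setT `&` [set y | (k.+1%:R^-1%:E <= `|(EFin \o m) y|)%E]).
  by apply: emeasurable_fun_c_infty => //; exact: measurableT_comp.
split; first by apply: measurableU => //; exact: measurable_zero_rV.
apply: le_lt_trans (measureU2 _ _ _) _ => //; first exact: measurable_zero_rV.
rewrite [X in (X + _)%E]nu0 add0e.
have k0 : (0 : R) < k.+1%:R^-1 by rewrite invr_gt0 ltr0n.
have := @le_integral_comp_abse _ _ _ nu _ measurableT _ _ id
  (@measurable_id _ _ _) (fun _ => id) (fun _ _ _ _ => id) mm k0.
rewrite [X in (_ <= X)%E -> _](_ : _ = \int[nu]_y (m y)%:E)%E; last first.
  by apply: eq_integral => y _; rewrite gee0_abs// lee_fin.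
move=> /le_lt_trans /(_ nu_fin).
by rewrite lte_pdivrMl// mulry gtr0_sg// ?mul1e// ltr0n.
Qed.

(** A jump [h] from the point [y] leads to [h + y]; in the coordinates [(y, h)]
    the double integral against [levy_at nu y] and Lebesgue measure becomes an
    integral against a product measure. *)
Definition shear {R : realType} {n : nat} (p : 'rV[R]_n * 'rV[R]_n) :=
  (p.2 + p.1, p.1).

Lemma measurable_shear {R : realType} {n : nat} : measurable_fun setT (@shear R n).
Proof.
apply: measurable_fun_pair => //; apply: measurable_fun_addrV.
- exact: measurable_snd.
- exact: measurable_fst.
Qed.

Lemma integral_levy_at {R : realType} {n : nat}
    (nu : {measure set 'rV[R]_n -> \bar R}) (F : 'rV[R]_n * 'rV[R]_n -> \bar R)
    (y : 'rV[R]_n) :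
  measurable_fun setT F -> (forall z, 0 <= F z)%E ->
  (\int[levy_at nu y]_x F (x, y) = \int[nu]_h F (shear (y, h)))%E.
Proof.
move=> mF F0.
have mFy : measurable_fun setT (fun x => F (x, y)).
  by apply: measurableT_comp => //; exact: measurable_fun_pair.
by have := @ge0_integral_pushforward _ _ _ _ R _ (measurable_translation y)
  nu setT _ measurableT mFy (fun _ _ => F0 _); rewrite preimage_setT.
Qed.

Lemma measurable_integral_levy_at {R : realType} {n : nat}
    (nu : {measure set 'rV[R]_n -> \bar R}) (F : 'rV[R]_n * 'rV[R]_n -> \bar R) :
  sigma_finite setT nu -> measurable_fun setT F -> (forall z, 0 <= F z)%E ->
  measurable_fun setT (fun y => \int[levy_at nu y]_x F (x, y))%E.
Proof.
move=> snu mF F0.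
rewrite (_ : (fun _ => _) = fun y => (\int[nu]_h (F \o shear) (y, h)))%E; last first.
  by apply/funext => y; exact: integral_levy_at.
apply: measurable_fun_integral_section => // [|z]; last exact: F0.
exact: (measurableT_comp mF measurable_shear).
Qed.

(** Integrating over the positions first isolates, for each jump [h], the
    contribution of the translation by [h]. *)
Lemma tonelli_levy_at {R : realType} {n : nat}
    (nu : {measure set 'rV[R]_n -> \bar R}) (F : 'rV[R]_n * 'rV[R]_n -> \bar R) :
  sigma_finite setT nu -> measurable_fun setT F -> (forall z, 0 <= F z)%E ->
  (\int[lebesgue_rV n]_y \int[levy_at nu y]_x F (x, y) =
   \int[nu]_h \int[lebesgue_rV n]_y F (shear (y, h)))%E.
Proof.
move=> snu mF F0.
under eq_integral do rewrite integral_levy_at//.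
apply: (fubini_tonelli_sigma_finite _ _ (F \o shear)) => // [||z]; last exact: F0.
- exact: sigma_finite_lebesgue_rV.
- exact: (measurableT_comp mF measurable_shear).
Qed.

(** * The negative part as a test function *)

(** The negative part is 1-Lipschitz, so taking it does not increase the energy. *)
Lemma neg_part_sub_sqr {R : realType} (a b : R) :
  (Num.max (- a) 0 - Num.max (- b) 0) ^+ 2 <= (a - b) ^+ 2.
Proof.
case: (leP (- a) 0) => a0; case: (leP (- b) 0) => b0.
- by rewrite subrr expr0n sqr_ge0.
- nra.
- nra.
- by rewrite -opprD sqrrN.
Qed.

(** Writing a = a^+ - a^-, the mixed term (a^+ - b^+) (a^- - b^-) equals
    - a^+ b^- - b^+ a^-, hence is nonpositive: the energy pairing of [u] with
    its negative part is at most minus the energy of the negative part, and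
    this already holds pointwise. *)
Lemma neg_part_energy {R : realType} (a b : R) :
  (a - b) * (Num.max (- a) 0 - Num.max (- b) 0) <=
  - (Num.max (- a) 0 - Num.max (- b) 0) ^+ 2.
Proof.
case: (leP (- a) 0) => a0; case: (leP (- b) 0) => b0; [|nra|nra|].
  by rewrite subrr mulr0 expr0n oppr0.
by rewrite -opprD sqrrN mulrN.
Qed.

Lemma funrneg_in_V {R : realType} {n : nat} (nu : {measure set 'rV[R]_n -> \bar R})
    (Omega : set 'rV[R]_n) (u : 'rV[R]_n -> R) :
  sigma_finite setT nu -> measurable Omega ->
  in_V nu Omega u -> in_V nu Omega u^\-.
Proof.
move=> snu mO [mu Vu].
have mn : measurable_fun setT u^\- by exact: measurable_funrneg.
split => //; apply: le_lt_trans Vu; apply: leeD.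
  apply: ge0_le_integral => //.
  - by move=> x _; rewrite lee_fin sqr_ge0.
  - by apply/measurable_EFinP/measurable_funX; exact: measurable_funS mn.
  - by apply/measurable_EFinP/measurable_funX; exact: measurable_funS mu.
  - move=> x _; rewrite lee_fin /funrneg.
    by have := neg_part_sub_sqr (u x) 0; rewrite oppr0 maxxx subr0 addr0.
have mdiff (v : 'rV[R]_n -> R) : measurable_fun setT v ->
    measurable_fun setT (fun z : 'rV[R]_n * 'rV[R]_n => ((v z.1 - v z.2) ^+ 2)%:E).
  move=> mv; apply/measurable_EFinP/measurable_funX/measurable_funB.
  - exact: measurableT_comp mv measurable_fst.
  - exact: measurableT_comp mv measurable_snd.
have sqr0 (v : 'rV[R]_n -> R) (z : 'rV[R]_n * 'rV[R]_n) :
    (0 <= ((v z.1 - v z.2) ^+ 2)%:E)%E by rewrite lee_fin sqr_ge0.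
have mint (v : 'rV[R]_n -> R) : measurable_fun setT v -> measurable_fun Omega
    (fun y => \int[levy_at nu y]_x ((v x - v y) ^+ 2)%:E)%E.
  move=> mv; apply: (measurable_funS measurableT) => //.
  exact: (measurable_integral_levy_at nu _ snu (mdiff _ mv) (sqr0 v)).
rewrite lee_pmul2l ?lte_fin ?invr_gt0//; apply: ge0_le_integral => //.
- by move=> y _; apply: integral_ge0 => x _; exact: (sqr0 _ (x, y)).
- exact: mint.
- exact: mint.
- move=> y _; apply: ge0_le_integral => //.
  + by move=> x _; exact: (sqr0 _ (x, y)).
  + exact: (measurableT_comp (mdiff _ mn) (measurable_pair2 y)).
  + exact: (measurableT_comp (mdiff _ mu) (measurable_pair2 y)).
  + by move=> x _; rewrite lee_fin neg_part_sub_sqr.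
Qed.

(** Testing the equation against [u^\-] gives a nonnegative right-hand side,
    while the left-hand side is at most minus half the energy of [u^\-].
    The left-hand integrand is nonpositive everywhere, so its opposite [G] can
    be compared with the energy density [F] inside extended-valued integrals
    of nonnegative functions. *)
Lemma weak_solution_neg_part_energy_eq0 {R : realType} {n : nat}
    (nu : {measure set 'rV[R]_n -> \bar R}) (Omega : set 'rV[R]_n)
    (f g u : 'rV[R]_n -> R) :
  sigma_finite setT nu -> measurable Omega -> measurable_fun Omega f ->
  {ae lebesgue_rV n, forall x, Omega x -> 0 <= f x} ->
  weak_solution nu Omega f g u -> in_H nu Omega u^\- ->
  (\int[lebesgue_rV n]_y \int[levy_at nu y]_x ((u^\- x - u^\- y) ^+ 2)%:E = 0)%E.
Proof.
move=> snu mO mf f0 [[mu _] _ /[apply]] weak.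
have mn : measurable_fun setT u^\- by exact: measurable_funrneg.
pose G (z : 'rV[R]_n * 'rV[R]_n) :=
  (- ((u z.1 - u z.2) * (u^\- z.1 - u^\- z.2)))%:E.
pose F (z : 'rV[R]_n * 'rV[R]_n) := ((u^\- z.1 - u^\- z.2) ^+ 2)%:E.
have mdiff (v : 'rV[R]_n -> R) : measurable_fun setT v ->
    measurable_fun setT (fun z : 'rV[R]_n * 'rV[R]_n => v z.1 - v z.2).
  move=> mv; apply: measurable_funB.
  - exact: measurableT_comp mv measurable_fst.
  - exact: measurableT_comp mv measurable_snd.
have mF : measurable_fun setT F.
  by apply/measurable_EFinP/measurable_funX; exact: mdiff.
have mG : measurable_fun setT G.
  apply/measurable_EFinP; apply: measurableT_comp => //.
  by apply: measurable_funM; exact: mdiff.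
have FG z : (F z <= G z)%E by rewrite lee_fin lerNr; exact: neg_part_energy.
have F0 z : (0 <= F z)%E by rewrite lee_fin sqr_ge0.
have G0 z : (0 <= G z)%E := le_trans (F0 z) (FG z).
have rhs0 : (0 <= \int[lebesgue_rV n]_(x in Omega) (f x * u^\- x)%:E)%E.
  have mnO : measurable_fun Omega u^\- := measurable_funS measurableT (@subsetT _ _) mn.
  (* [f] is only almost everywhere nonnegative: replacing it by its absolute
     value makes the integrand nonnegative everywhere. *)
  rewrite (ae_eq_integral (fun x => (`|f x| * u^\- x)%:E)) //.
  - by apply: integral_ge0 => x _; rewrite lee_fin mulr_ge0// funrneg_ge0.
  - by apply/measurable_EFinP; exact: measurable_funM.
  - by apply/measurable_EFinP; apply: measurable_funM => //; exact: measurableT_comp.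
  - by apply: filterS f0 => x fx Ox; rewrite ger0_norm// fx.
have lhsE : (\int[lebesgue_rV n]_y
    \int[levy_at nu y]_x ((u x - u y) * (u^\- x - u^\- y))%:E =
    - \int[lebesgue_rV n]_y \int[levy_at nu y]_x G (x, y))%E.
  rewrite -integral_ge0N => [|y _]; last first.
    by apply: integral_ge0 => x _; exact: G0.
  apply: eq_integral => y _; rewrite -integral_ge0N => [|x _]; last exact: G0.
  by apply: eq_integral => x _; rewrite /G /= opprK.
move: rhs0; rewrite -weak lhsE muleN oppe_ge0 => IG0.
have Fy y : (0 <= \int[levy_at nu y]_x F (x, y))%E.
  by apply: integral_ge0 => x _; exact: F0.
have mIF := measurable_integral_levy_at nu F snu mF F0.
have mIG := measurable_integral_levy_at nu G snu mG G0.
apply/eqP; rewrite eq_le; apply/andP; split; last first.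
  by apply: integral_ge0 => y _; exact: Fy.
apply: (@le_trans _ _ (\int[lebesgue_rV n]_y
  \int[levy_at nu y]_x G (x, y))%E); last first.
  by move: IG0; rewrite pmule_rle0// lte_fin invr_gt0.
apply: ge0_le_integral => // y _; apply: ge0_le_integral => //.
- by move=> x _; exact: (F0 (x, y)).
- exact: (measurableT_comp mF (measurable_pair2 y)).
- exact: (measurableT_comp mG (measurable_pair2 y)).
- by move=> x _; exact: (FG (x, y)).
Qed.

(** * Vanishing of functions with zero energy *)

(** For almost every [x] the function [w] is constant along the whole
    progression [x + h *+ k].  As [h] is nonzero, this progression eventually
    leaves the bounded set [Omega], where [w] vanishes. *)
Lemma ae_periodic_bounded_support_eq0 {R : realType} {n : nat}
    (Omega : set 'rV[R]_n) (w : 'rV[R]_n -> R) (h : 'rV[R]_n) :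
  bounded_set Omega -> h != 0 ->
  {ae lebesgue_rV n, forall x, (~` Omega) x -> w x = 0} ->
  {ae lebesgue_rV n, forall x, w (h + x) = w x} ->
  {ae lebesgue_rV n, forall x, w x = 0}.
Proof.
move=> bO h0 w0 wh.
have ae_w0 : {ae lebesgue_rV n, forall x, forall k,
    (~` Omega) (x + h *+ k) -> w (x + h *+ k) = 0}.
  by apply: ae_foralln => k; exact: (ae_translate (h *+ k) _ w0).
have ae_wh : {ae lebesgue_rV n, forall x, forall k,
    w (h + (x + h *+ k)) = w (x + h *+ k)}.
  by apply: ae_foralln => k; exact: (ae_translate (h *+ k) _ wh).
apply: filterS2 ae_w0 ae_wh => x w0x whx.
have wxE k : w (x + h *+ k) = w x.
  elim: k => [|k IH]; first by rewrite mulr0n addr0.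
  by rewrite mulrS addrCA whx.
have [i hi] := row_neq0_coord _ h0.
have [M M0 OM] : exists2 M, 0 < M & (forall x, Omega x -> `|x| <= M).
  exact: (pinfty_ex_gt (real0 _) bO).
(* [k] steps move coordinate [i] by more than [M + `|x 0 i|], hence out of the
   ball of radius [M] that contains [Omega]. *)
pose k := Num.bound ((M + `|x 0 i|) / `|h 0 i|).
rewrite -(wxE k); apply: w0x => /OM; apply/negP; rewrite -ltNge.
apply: lt_le_trans (norm_coord_le _ i).
have hi0 : 0 < `|h 0 i| by rewrite normr_gt0.
have kM : M + `|x 0 i| < `|h 0 i| *+ k.
  rewrite -mulr_natl -ltr_pdivrMr//.
  by rewrite archi_boundP// divr_ge0// addr_ge0// ltW.
rewrite !mxE mulmxnE -normrMn in kM *.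
have := lerB_normD (h 0 i *+ k) (x 0 i).
rewrite [_ + x 0 i]addrC; lra.
Qed.

Lemma ae_exists_neq0 {R : realType} {n : nat}
    (nu : {measure set 'rV[R]_n -> \bar R}) (P : 'rV[R]_n -> Prop) :
  nu [set 0] = 0%E -> nu setT <> 0%E ->
  {ae nu, forall h, P h} -> exists2 h, h != 0 & P h.
Proof.
move=> nu0 nuT [N [mN N0 PN]]; apply: contrapT => noh; apply: nuT.
apply: (subset_measure0 measurableT (measurableU _ _ mN measurable_zero_rV)).
  move=> h _; have [->|h0] := eqVneq h 0; first by right.
  by left; apply: PN => Ph; apply: noh; exists h.
apply/eqP; rewrite -measure_le0.
rewrite (le_trans (measureU2 _ mN measurable_zero_rV))//.
by rewrite [X in (X + _)%E]N0 [X in (_ + X)%E]nu0 adde0.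
Qed.

(** After exchanging the integrals, the energy is the integral over the jumps
    [h] of the squared L^2 norm of the difference between [w] and its
    translate by [h]; a nonnegative integrand with zero integral vanishes
    almost everywhere. *)
Lemma dirichlet_eq0_ae_translate {R : realType} {n : nat}
    (nu : {measure set 'rV[R]_n -> \bar R}) (w : 'rV[R]_n -> R) :
  sigma_finite setT nu -> measurable_fun setT w ->
  (\int[lebesgue_rV n]_y \int[levy_at nu y]_x ((w x - w y) ^+ 2)%:E = 0)%E ->
  {ae nu, forall h, {ae lebesgue_rV n, forall x, w (h + x) = w x}}.
Proof.
move=> snu mw E0.
pose F (z : 'rV[R]_n * 'rV[R]_n) := ((w z.1 - w z.2) ^+ 2)%:E.
have mF : measurable_fun setT F.
  apply/measurable_EFinP/measurable_funX/measurable_funB.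
  - exact: measurableT_comp mw measurable_fst.
  - exact: measurableT_comp mw measurable_snd.
have F0 z : (0 <= F z)%E by rewrite lee_fin sqr_ge0.
have mFs := measurableT_comp mF (@measurable_shear R n).
move: E0; rewrite (tonelli_levy_at nu F)// => E0.
have mswap : measurable_fun setT
    (fun p : 'rV[R]_n * 'rV[R]_n => (F \o shear) (p.2, p.1)).
  apply: measurableT_comp mFs _; apply: measurable_fun_pair.
  - exact: measurable_snd.
  - exact: measurable_fst.
have mE : measurable_fun setT (fun h => \int[lebesgue_rV n]_y (F \o shear) (y, h))%E.
  apply: (measurable_fun_integral_section (lebesgue_rV n)
    (fun p => (F \o shear) (p.2, p.1))) => // [|z]; last exact: F0.
  exact: sigma_finite_lebesgue_rV.
have Ege0 h : (0 <= \int[lebesgue_rV n]_y (F \o shear) (y, h))%E.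
  by apply: integral_ge0 => y _; exact: F0.
apply: filterS (ge0_integral_eq0_ae _ _ mE Ege0 E0) => h Eh.
have mFh : measurable_fun setT (fun y => (F \o shear) (y, h)).
  apply: measurableT_comp mFs _; apply: measurable_fun_pair.
  - exact: measurable_id.
  - exact: measurable_cst.
apply: filterS (ge0_integral_eq0_ae _ _ mFh (fun y => F0 _) Eh) => y.
by move=> [] /eqP; rewrite sqrf_eq0 subr_eq0 => /eqP.
Qed.

Theorem theorem5p1 (R : realType) (n : nat) (nu : {measure set 'rV[R]_n -> \bar R})
    (Omega : set 'rV[R]_n) (f g u : 'rV[R]_n -> R)
    (nu_levy : symmetric_levy_measure nu)
    (nu_neq0 : nu setT <> 0%E)
    (Omega_neq0 : Omega !=set0) (Omega_open : open Omega)
    (Omega_bounded : bounded_set Omega)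
    (f_L2 : in_L2 Omega f)
    (f_ge0 : {ae lebesgue_rV n, forall x, Omega x -> 0 <= f x})
    (g_ge0 : {ae lebesgue_rV n, forall x, (~` Omega) x -> 0 <= g x})
    (u_sol : weak_solution nu Omega f g u) :
  {ae lebesgue_rV n, forall x, 0 <= u x}.
Proof.
have snu := sigma_finite_levy nu nu_levy.
have mO := measurable_open_rV _ Omega_open.
have [u_V u_g _] := u_sol.
have un_ext : {ae lebesgue_rV n, forall x, (~` Omega) x -> u^\- x = 0}.
  apply: filterS2 g_ge0 u_g => x gx ux Ox.
  by rewrite /funrneg (ux Ox); apply: max_r; rewrite oppr_le0; exact: gx.
have un_H : in_H nu Omega u^\- by split => //; exact: funrneg_in_V.
have E0 := weak_solution_neg_part_energy_eq0 _ _ _ _ _ snu mO f_L2.1 f_ge0 u_sol un_H.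
have mun : measurable_fun setT u^\- := un_H.1.1.
have [nu0 _ _] := nu_levy.
have [h h0 un_h] := ae_exists_neq0 _ _ nu0 nu_neq0
  (dirichlet_eq0_ae_translate _ _ snu mun E0).
have := ae_periodic_bounded_support_eq0 _ _ _ Omega_bounded h0 un_ext un_h.
apply: filterS => x unx0.
by rewrite -oppr_le0 -unx0 /funrneg le_max lexx.
Qed.
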